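(* Let $T\in\mathcal C(H_1,H_2)$ be a densely defined closed linear operator. Then for each $\epsilon>0$ there exists a bounded linear operator $S\in\mathcal B(H_1,H_2)$ such that (1) $\|S\|\le\epsilon$; (2) $N(T)=N(T+S)$; and (3) $T+S$ attains its reduced minimum, i.e. there exists $x_0\in C(T+S)$ with $\|x_0\|=1$ and $\|(T+S)x_0\|=\gamma(T+S)$. Moreover, if $\gamma(T)>0$, then $S$ can be chosen to be a rank one operator.
   Context: $H_1,H_2$ are infinite dimensional complex Hilbert spaces. $\mathcal C(H_1,H_2)$ denotes the class of densely defined closed linear operators from a dense subspace $D(T)\subseteq H_1$ into $H_2$; $\mathcal B(H_1,H_2)$ denotes the space of (everywhere defined) bounded linear operators from $H_1$ to $H_2$. $N(T)$ denotes the null space of $T$. $T+S$ has domain $D(T)\cap D(S)=D(T)$. For an operator $T\in\mathcal C(H_1,H_2)$, the carrier is $C(T):=D(T)\cap N(T)^{\perp}$ and the reduced minimum modulus is $\gamma(T):=\inf\{\|Tx\|: x\in C(T),\ \|x\|=1\}$.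
   Formalization: The formal statement additionally assumes T is not the zero operator; for T = 0 one has N(T) = H1, so (2) forces S = 0, the carrier C(T+S) is {0} with no unit vector, and (3) fails. *)

(* Defs.v *)
From HB Require Import structures.
From mathcomp Require Import all_boot all_order all_algebra.
From mathcomp Require Import complex.
From mathcomp Require Import all_classical all_reals all_analysis.

Set Implicit Arguments.
Unset Strict Implicit.
Unset Printing Implicit Defensive.

Import Order.TTheory GRing.Theory Num.Theory.
Import numFieldNormedType.Exports.

Local Open Scope classical_set_scope.
Local Open Scope ring_scope.

(* {dot H for Num.conj} is the library's positive definite Hermitian form,
   linear in its first argument and conjugate-linear in its second. *)
HB.mixin Record CompleteNormedModule_isHilbert (R : realType) H
    & CompleteNormedModule R[i] H := {
  hdot : {dot H for (@Num.conj R[i])} ;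
  hdot_norm : forall x : H, hdot x x = `|x| ^+ 2
}.

#[short(type="hilbertType")]
HB.structure Definition Hilbert (R : realType) :=
  {H of CompleteNormedModule R[i] H & CompleteNormedModule_isHilbert R H}.

(* The norm of an R[i]-normed module takes (real, nonnegative) values in R[i];
   hnorm is the same number seen in R. *)
Definition hnorm (R : realType) (H : hilbertType R) (x : H) : R :=
  complex.Re `|x|.

Definition infinite_dim (R : realType) (H : hilbertType R) : Prop :=
  ~ exists (n : nat) (e : 'I_n -> H),
      forall x, exists c : 'I_n -> R[i], x = \sum_(i < n) c i *: e i.

(* A linear operator defined on a subspace. The underlying function is total,
   but its values outside [dom] are irrelevant: every notion below only looks
   at it on [dom]. *)
Record linop (R : realType) (H1 H2 : hilbertType R) := LinOp {
  dom : set H1 ;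
  op :> H1 -> H2 ;
  dom0 : dom 0 ;
  dom_lin : forall (a : R[i]) x y, dom x -> dom y -> dom (a *: x + y) ;
  op_lin : forall (a : R[i]) x y, dom x -> dom y ->
    op (a *: x + y) = a *: op x + op y
}.

Section Operators.
Variables (R : realType) (H1 H2 : hilbertType R).
Implicit Types (T : linop H1 H2) (S : {linear H1 -> H2}).

Definition graph T : set (H1 * H2) := [set p | dom T p.1 /\ p.2 = T p.1].

Definition closed_densely_defined T : Prop :=
  dense (dom T) /\ closed (graph T).

Program Definition total_linop S : linop H1 H2 :=
  @LinOp R H1 H2 [set: H1] S _ _ _.
Next Obligation. by []. Qed.
Next Obligation. by []. Qed.
Next Obligation. by move=> S a x y _ _; rewrite linearP. Qed.

Program Definition add_linop T1 T2 : linop H1 H2 :=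
  @LinOp R H1 H2 (dom T1 `&` dom T2) (fun x => T1 x + T2 x) _ _ _.
Next Obligation. by move=> T1 T2; split; exact: dom0. Qed.
Next Obligation.
by move=> T1 T2 a x y [x1 x2] [y1 y2]; split; exact: dom_lin.
Qed.
Next Obligation.
by move=> T1 T2 a x y [x1 x2] [y1 y2]; rewrite !op_lin// scalerDr addrACA.
Qed.

Definition null T : set H1 := [set x | dom T x /\ T x = 0].

Definition ortho (A : set H1) : set H1 :=
  [set x | forall y, A y -> hdot x y = 0].

Definition carrier T : set H1 := dom T `&` ortho (null T).

(* Valued in \bar R, so that the infimum over the empty set is +oo. *)
Definition reduced_min_modulus T : \bar R :=
  ereal_inf [set (hnorm (T x))%:E | x in [set x | carrier T x /\ hnorm x = 1]].

Definition attains_reduced_min T : Prop :=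
  exists x0, [/\ carrier T x0, hnorm x0 = 1 &
                 (hnorm (T x0))%:E = reduced_min_modulus T].

Definition bounded_linear S : Prop :=
  exists M : R, forall x, hnorm (S x) <= M * hnorm x.

Definition op_norm S : \bar R :=
  ereal_sup [set (hnorm (S x))%:E | x in [set x | hnorm x <= 1]].

Definition rank_one S : Prop :=
  exists2 y : H2, y != 0 & range S = [set c *: y | c in [set: R[i]]].

End Operators.

(* Main.v *)
Require Import Defs.
From HB Require Import structures.
From mathcomp Require Import all_boot all_order all_algebra.
From mathcomp Require Import complex.
From mathcomp Require Import all_classical all_reals all_analysis.
From mathcomp Require Import ring lra.
Import Order.TTheory GRing.Theory Num.Theory.
Import numFieldNormedType.Exports.
Local Open Scope complex_scope.
Local Open Scope classical_set_scope.
Local Open Scope ring_scope.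

(* If [g = gamma(T) > 0], take a unit vector [x0] of the carrier with [T x0]
   nearly of norm [g], and let [v] be the component of [T x0] orthogonal to the
   (closed) image of the carrier vectors orthogonal to [x0]. Then
   [g <= |v| <= |T x0|], so a multiple [t v] of norm slightly below [g] is close
   to [T x0], and the rank one perturbation sending [x0] to [t v - T x0] yields
   an operator for which [x0] is orthogonally decoupled and minimal.

   In general one first moves to an operator that is bounded below on the
   carrier. With [T = V |T|] and [B = (1 + T^* T)^-1], the perturbation is a
   small multiple of [Q = V B^(1/2)]: [Q] makes an acute angle with [T], and
   [|Q x|^2 = <B x, x>] is not small where [T x] is. No polar decomposition is
   needed, since [Q = T B (1 - B)^(-1/2)] is the strong sum of
   [a_n T B (B^n)] with [a_n = binom(2n, n) / 4^n]; norms of partial sums only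
   involve the moments [<B^n x, x>], which decrease, and [a * a = 1]. *)

Set Implicit Arguments.
Unset Strict Implicit.
Unset Printing Implicit Defensive.

(** * Real inner product and convergence *)

Section RealInnerProduct.
Variables (R : realType) (H : hilbertType R).
Implicit Types (x y z : H) (r : R) (c : R[i]).

Definition rdot x y : R := complex.Re (hdot x y).

Lemma hdotC x y : hdot x y = Num.conj (hdot y x).
Proof. by rewrite hermC expr0 mul1r. Qed.

Lemma rdotC x y : rdot x y = rdot y x.
Proof. by rewrite /rdot hdotC; case: (hdot y x). Qed.

Lemma rdotDl x y z : rdot (x + y) z = rdot x z + rdot y z.
Proof. by rewrite /rdot linearDl raddfD. Qed.

Lemma rdotNl x y : rdot (- x) y = - rdot x y.
Proof. by rewrite /rdot linearNl raddfN. Qed.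

Lemma rdotZl r x y : rdot (r%:C *: x) y = r * rdot x y.
Proof. by rewrite /rdot linearZl_LR /=; case: (hdot x y) => a b /=; rewrite mul0r subr0. Qed.

Lemma rdotDr x y z : rdot z (x + y) = rdot z x + rdot z y.
Proof. by rewrite rdotC rdotDl !(rdotC _ z). Qed.

Lemma rdotNr x y : rdot y (- x) = - rdot y x.
Proof. by rewrite rdotC rdotNl rdotC. Qed.

Lemma rdotZr r x y : rdot y (r%:C *: x) = r * rdot y x.
Proof. by rewrite rdotC rdotZl rdotC. Qed.

Lemma rdot0l x : rdot 0 x = 0.
Proof. by rewrite /rdot linear0l. Qed.

Lemma rdot0r x : rdot x 0 = 0.
Proof. by rewrite rdotC rdot0l. Qed.

Definition rdotE := (rdotDl, rdotDr, rdotNl, rdotNr, rdotZl, rdotZr).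

Lemma rdot_suml (I : Type) (s : seq I) (F : I -> H) y :
  rdot (\sum_(i <- s) F i) y = \sum_(i <- s) rdot (F i) y.
Proof.
by elim/big_rec2: _ => [|i a b _ <-]; rewrite ?rdot0l ?rdotDl.
Qed.

Lemma rdot_sumr (I : Type) (s : seq I) (F : I -> H) y :
  rdot y (\sum_(i <- s) F i) = \sum_(i <- s) rdot y (F i).
Proof. by rewrite rdotC rdot_suml; apply: eq_bigr => i _; rewrite rdotC. Qed.

Lemma normc_hnorm x : `|x| = (hnorm x)%:C.
Proof.
rewrite /hnorm; have := normr_ge0 x.
by case: (`|x|) => a b; rewrite lecE /= => /andP[/eqP-> _].
Qed.

Lemma hnorm_ge0 x : 0 <= hnorm x.
Proof. by have := normr_ge0 x; rewrite normc_hnorm lecR. Qed.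

Lemma rdotxx x : rdot x x = hnorm x ^+ 2.
Proof. by rewrite /rdot hdot_norm normc_hnorm -rmorphXn. Qed.

Lemma rdot_ge0 x : 0 <= rdot x x.
Proof. by rewrite rdotxx sqr_ge0. Qed.

Lemma hnorm_triangle x y : hnorm (x + y) <= hnorm x + hnorm y.
Proof. by have := ler_normD x y; rewrite !normc_hnorm -rmorphD lecR. Qed.

Lemma hnorm_opp x : hnorm (- x) = hnorm x.
Proof. by rewrite /hnorm normrN. Qed.

Lemma hdistC x y : hnorm (x - y) = hnorm (y - x).
Proof. by rewrite -hnorm_opp opprB. Qed.

Lemma hnormZ c x : hnorm (c *: x) = complex.Re `|c| * hnorm x.
Proof.
rewrite /hnorm normrZ (normc_hnorm x); have := normr_ge0 c.
by case: (`|c|) => a b; rewrite lecE /= => /andP[/eqP-> _]; rewrite !mulr0 subr0.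
Qed.

Lemma hnormZr r x : hnorm (r%:C *: x) = `|r| * hnorm x.
Proof.
by rewrite hnormZ normc_def /= expr0n addr0 sqrtr_sqr.
Qed.

Lemma hnorm0 : hnorm (0 : H) = 0.
Proof. by rewrite /hnorm normr0. Qed.

Lemma hnorm_eq0 x : (hnorm x == 0) = (x == 0).
Proof. by rewrite -(normr_eq0 x) normc_hnorm eq_complex /= eqxx andbT. Qed.

Lemma rdotxx_eq0 x : (rdot x x == 0) = (x == 0).
Proof. by rewrite rdotxx sqrf_eq0 hnorm_eq0. Qed.

(** Cauchy-Schwarz: expand the squared norm of [|y| x - |x| y] and divide by [|x| |y|]. *)
Lemma rdot_le x y : rdot x y <= hnorm x * hnorm y.
Proof.
have [->|y0] := eqVneq y 0; first by rewrite rdot0r hnorm0 mulr0.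
have [->|x0] := eqVneq x 0; first by rewrite rdot0l hnorm0 mul0r.
have {}x0 : 0 < hnorm x by rewrite lt_def hnorm_eq0 x0 hnorm_ge0.
have {}y0 : 0 < hnorm y by rewrite lt_def hnorm_eq0 y0 hnorm_ge0.
have := rdot_ge0 ((hnorm y)%:C *: x - (hnorm x)%:C *: y).
rewrite !rdotE !rdotxx (rdotC y x) => h.
have xy0 : 0 < hnorm x * hnorm y by rewrite mulr_gt0.
rewrite -(ler_pM2l xy0); nra.
Qed.

(** Multiplying [y] by [c = hdot x y] turns the form into the real number [|c|^2], so the real
    Cauchy-Schwarz inequality gives the complex one. *)
Lemma normc_hdot x y : complex.Re `|hdot x y| <= hnorm x * hnorm y.
Proof.
set c := hdot x y.
have e : rdot x (c *: y) = complex.Re `|c| ^+ 2.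
  rewrite normc_def /rdot linearZr_LR /= -/c mulrC -normCK -add_Re2_Im2 /=.
  by rewrite sqr_sqrtr ?addr_ge0 ?sqr_ge0.
have c0 : 0 <= complex.Re `|c| by have := normr_ge0 c; rewrite lecE => /andP[].
have := rdot_le x (c *: y); rewrite e hnormZ.
have [->|] := eqVneq (complex.Re `|c|) 0; first by rewrite mulr_ge0 ?hnorm_ge0.
move=> cn; have {}cn : 0 < complex.Re `|c| by rewrite lt_def cn.
by rewrite mulrCA expr2 ler_pM2l.
Qed.

(** Testing against [hdot x y *: y] instead of [y] gives [|hdot x y|^2 = 0]. *)
Lemma rdot_eq0_hdot x (A : set H) : (forall c y, A y -> A (c *: y)) ->
  (forall y, A y -> rdot x y = 0) -> forall y, A y -> hdot x y = 0.
Proof.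
move=> AZ A0 y Ay; have := A0 _ (AZ (hdot x y) _ Ay).
rewrite /rdot linearZr_LR /=; case: (hdot x y) => a b /=.
move=> h; apply/eqP; rewrite eq_complex /=.
have : a ^+ 2 + b ^+ 2 = 0 by rewrite -[RHS]h; ring.
by move/eqP; rewrite paddr_eq0 ?sqr_ge0// !sqrf_eq0.
Qed.

Lemma hdot_eq0C x y : hdot x y = 0 -> hdot y x = 0.
Proof. by move=> xy; rewrite hdotC xy conjC0. Qed.

Lemma hdot_rdot0 x y : hdot x y = 0 -> rdot x y = 0.
Proof. by rewrite /rdot => ->. Qed.

End RealInnerProduct.

(** * Norm convergence measured in [R], completeness and continuity of the form *)

Section Convergence.
Variables (R : realType) (H : hilbertType R).
Implicit Types (u v : nat -> H) (l m x : H).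

Definition hcvg u l := (fun n => hnorm (u n - l)) @ \oo --> (0 : R).

Lemma hcvgP u l :
  hcvg u l <-> forall e, 0 < e -> \forall n \near \oo, hnorm (u n - l) < e.
Proof.
split=> [/cvgrPdist_lt h e /h|h].
  by apply: filterS => n; rewrite sub0r normrN ger0_norm ?hnorm_ge0.
apply/cvgrPdist_lt => e /h.
by apply: filterS => n; rewrite sub0r normrN ger0_norm ?hnorm_ge0.
Qed.

(** Radii in the topology of [H] are elements of [R[i]], but a positive one has zero imaginary
    part. *)
Lemma hcvg_cvg u l : hcvg u l <-> u @ \oo --> l.
Proof.
split=> [/hcvgP h|/cvgrPdist_lt h].
  apply/cvgrPdist_lt => e e0.
  have eE : e = (complex.Re e)%:C.
    by case: e e0 => a b; rewrite ltcE /= => /andP[/eqP->].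
  rewrite eE ltcR in e0; have := h _ e0.
  by apply: filterS => n; rewrite distrC normc_hnorm eE ltcR.
apply/hcvgP => e e0; have := h e%:C; rewrite ltcR => /(_ e0).
by apply: filterS => n; rewrite distrC normc_hnorm ltcR.
Qed.

Lemma hcvg_complete u :
  (forall e, 0 < e -> exists N, forall i j, (N <= i)%N -> (N <= j)%N ->
    hnorm (u i - u j) < e) -> exists l, hcvg u l.
Proof.
move=> h; suff : cvg (u @ \oo) by move=> /cvg_ex[l /hcvg_cvg]; exists l.
apply: cauchy_cvg; apply/cauchy_ballP => e e0.
have eE : e = (complex.Re e)%:C.
  by case: e e0 => a b; rewrite ltcE /= => /andP[/eqP->].
rewrite eE ltcR in e0; have [N hN] := h _ e0.
exists (u @` [set n | (N <= n)%N], u @` [set n | (N <= n)%N]).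
  by split; exists N => // n /= Nn; exists n.
move=> [_ _] [/= [i Ni <-] [j Nj <-]].
by rewrite -ball_normE /= eE normc_hnorm ltcR hN.
Qed.

Lemma hcvg_unique u l m : hcvg u l -> hcvg u m -> l = m.
Proof.
move=> /hcvg_cvg ul /hcvg_cvg um; exact: (cvg_unique _ ul um).
Qed.

Lemma hcvgD u v l m : hcvg u l -> hcvg v m -> hcvg (fun n => u n + v n) (l + m).
Proof. by rewrite !hcvg_cvg; exact: cvgD. Qed.

Lemma hcvgZ c u l : hcvg u l -> hcvg (fun n => c *: u n) (c *: l).
Proof. by rewrite !hcvg_cvg; by apply: cvgZ => //; exact: cvg_cst. Qed.

Lemma hcvgB u v l m : hcvg u l -> hcvg v m -> hcvg (fun n => u n - v n) (l - m).
Proof. by rewrite !hcvg_cvg; exact: cvgB. Qed.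

Lemma hcvg_cst l : hcvg (fun=> l) l.
Proof. by rewrite hcvg_cvg; exact: cvg_cst. Qed.

Lemma cvg_hnorm u l : hcvg u l -> (fun n => hnorm (u n)) @ \oo --> hnorm l.
Proof.
move=> ul; apply/cvgrPdist_lt => e e0; have /hcvgP/(_ _ e0) := ul.
apply: filterS => n; apply: le_lt_trans; rewrite ler_norml.
have := hnorm_triangle (u n - l) l; have := hnorm_triangle (l - u n) (u n).
by rewrite !subrK (hdistC l); lra.
Qed.

Lemma cvg_rdot u v l m : hcvg u l -> hcvg v m ->
  (fun n => rdot (u n) (v n)) @ \oo --> rdot l m.
Proof.
move=> ul vm.
(* Polarization reduces continuity of the form to continuity of the norm. *)
have polar x y : rdot x y = (hnorm (x + y) ^+ 2 - hnorm (x - y) ^+ 2) / 4.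
  by rewrite -!rdotxx !rdotE (rdotC y x); field.
have -> : (fun n => rdot (u n) (v n)) =
    fun n => (hnorm (u n + v n) ^+ 2 - hnorm (u n - v n) ^+ 2) / 4.
  by apply/funext => n; exact: polar.
rewrite polar; apply: cvgM; last exact: cvg_cst.
apply: cvgB.
- rewrite expr2; under eq_fun do rewrite expr2.
  by apply: cvgM; apply: cvg_hnorm; apply: hcvgD.
- rewrite expr2; under eq_fun do rewrite expr2.
  by apply: cvgM; apply: cvg_hnorm; apply: hcvgB.
Qed.

End Convergence.

(** The first-order condition at a minimum. The choice [t = r / (q + 1)] stays legitimate when
    [q = 0]. *)
Lemma quadratic_slope0 (R : realFieldType) (r q : R) : 0 <= q ->
  (forall t, 2 * t * r <= t ^+ 2 * q) -> r = 0.
Proof.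
move=> q0 /(_ (r / (q + 1))) h; apply/eqP; rewrite -sqrf_eq0 eq_le sqr_ge0 andbT.
have q1 : 0 < q + 1 by lra.
have : (r / (q + 1)) ^+ 2 * (q + 2) <= 0.
  have -> : (r / (q + 1)) ^+ 2 * (q + 2) =
    2 * (r / (q + 1)) * r - (r / (q + 1)) ^+ 2 * q by field; rewrite gt_eqF.
  by rewrite subr_le0.
rewrite pmulr_lle0; last by lra.
by rewrite expr_div_n pmulr_lle0// invr_gt0 exprn_gt0.
Qed.

(** * Orthogonal projection onto a closed subspace of [H1 * H2] *)

Section Projection.
Variables (R : realType) (H1 H2 : hilbertType R) (A : H1 -> H2 -> Prop).
Hypothesis A0 : A 0 0.
Hypothesis A_lin : forall (c : R[i]) x1 x2 y1 y2,
  A x1 x2 -> A y1 y2 -> A (c *: x1 + y1) (c *: x2 + y2).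
Hypothesis A_closed : forall u v l m,
  (forall n : nat, A (u n) (v n)) -> hcvg u l -> hcvg v m -> A l m.

(** A minimizing sequence for the distance converges, and its limit is the foot of the
    perpendicular. Stating it for pairs serves graphs of operators as well as subspaces of one
    factor, the other component being held at 0. *)
Lemma projection (w1 : H1) (w2 : H2) : exists u1 u2, A u1 u2 /\
  forall v1 v2, A v1 v2 -> hdot (w1 - u1) v1 + hdot (w2 - u2) v2 = 0.
Proof.
pose d2 u1 u2 := rdot (w1 - u1) (w1 - u1) + rdot (w2 - u2) (w2 - u2).
have d2_ge0 u1 u2 : 0 <= d2 u1 u2 by rewrite addr_ge0 ?rdot_ge0.
pose E := [set r | exists u1 u2, A u1 u2 /\ r = d2 u1 u2].
have infE : has_inf E.
  split; first by exists (d2 0 0), 0, 0.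
  by exists 0 => _ [u1 [u2 [_ ->]]].
have lbE u1 u2 : A u1 u2 -> inf E <= d2 u1 u2.
  by move=> Au; apply: ge_inf; [case: infE|exists u1, u2].
have /choice[p pE] n : exists p : H1 * H2,
    A p.1 p.2 /\ d2 p.1 p.2 < inf E + n.+1%:R^-1.
  have [|_ [u1 [u2 [Au ->]]] lt] := @inf_adherent _ E n.+1%:R^-1 _ infE.
    by rewrite invr_gt0.
  by exists (u1, u2).
(* Parallelogram law: the midpoint of [p i] and [p j] lies in [A], so its squared distance is at
   least [inf E]. *)
have dist_p i j : rdot ((p i).1 - (p j).1) ((p i).1 - (p j).1)
    + rdot ((p i).2 - (p j).2) ((p i).2 - (p j).2)
    <= 2 * i.+1%:R^-1 + 2 * j.+1%:R^-1.
  have [Ai di] := pE i; have [Aj dj] := pE j.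
  have Ah : A ((2^-1)%:C *: ((p i).1 + (p j).1)) ((2^-1)%:C *: ((p i).2 + (p j).2)).
    have := A_lin (2^-1)%:C Ai (A_lin (2^-1)%:C Aj A0).
    by rewrite !addr0 -!scalerDr.
  have := lbE _ _ Ah; move: di dj; rewrite /d2 !rdotE.
  rewrite !(rdotC _ w1) !(rdotC _ w2) (rdotC (p j).1 (p i).1) (rdotC (p j).2 (p i).2).
  by move: (i.+1%:R^-1) (j.+1%:R^-1) => a b; lra.
have cauchy (e : R) : 0 < e -> exists N, forall i j, (N <= i)%N -> (N <= j)%N ->
    2 * i.+1%:R^-1 + 2 * j.+1%:R^-1 < e ^+ 2.
  move=> e0; have e20 : 0 < e ^+ 2 / 4 by rewrite divr_gt0 ?exprn_gt0.
  have [N _ hN] := near_infty_natSinv_lt (PosNum e20).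
  exists N => i j Ni Nj; have := hN i Ni; have := hN j Nj.
  by rewrite /=; move: (i.+1%:R^-1) (j.+1%:R^-1) => a b; lra.
have [l1 p1] : exists l, hcvg (fun n => (p n).1) l.
  apply: hcvg_complete => e e0; have [N hN] := cauchy e e0.
  exists N => i j Ni Nj; rewrite -(@ltr_pXn2r _ 2)// ?nnegrE ?hnorm_ge0 ?ltW//.
  rewrite -rdotxx; apply: le_lt_trans (hN i j Ni Nj).
  by apply: le_trans (dist_p i j); rewrite lerDl rdot_ge0.
have [l2 p2] : exists l, hcvg (fun n => (p n).2) l.
  apply: hcvg_complete => e e0; have [N hN] := cauchy e e0.
  exists N => i j Ni Nj; rewrite -(@ltr_pXn2r _ 2)// ?nnegrE ?hnorm_ge0 ?ltW//.
  rewrite -rdotxx; apply: le_lt_trans (hN i j Ni Nj).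
  by apply: le_trans (dist_p i j); rewrite lerDr rdot_ge0.
have Al : A l1 l2 by apply: (A_closed _ p1 p2) => n; have [] := pE n.
have d2l : d2 l1 l2 <= inf E.
  have c1 : (fun n => inf E + n.+1%:R^-1) @ \oo --> inf E + 0.
    by apply: cvgD; [exact: cvg_cst|exact: cvg_harmonic].
  have c2 : (fun n => d2 (p n).1 (p n).2) @ \oo --> d2 l1 l2.
    apply: cvgD; apply: cvg_rdot; apply: hcvgB => //; exact: hcvg_cst.
  rewrite addr0 in c1; apply: (ler_cvg_to c2 c1).
  by apply: nearW => n; have [_ /ltW] := pE n.
exists l1, l2; split => //.
(* Moving the minimizer by a real multiple of [v] cannot decrease the distance. *)
have re0 v1 v2 : A v1 v2 -> rdot (w1 - l1) v1 + rdot (w2 - l2) v2 = 0.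
  move=> Av; apply: (@quadratic_slope0 _ _ (rdot v1 v1 + rdot v2 v2)).
    by rewrite addr_ge0 ?rdot_ge0.
  move=> t; have := lbE _ _ (A_lin t%:C Av Al); move: d2l.
  rewrite /d2 !opprD ![- (_ *: _) + _]addrC !addrA.
  move: (w1 - l1) (w2 - l2) => z1 z2.
  rewrite !rdotE (rdotC v1 z1) (rdotC v2 z2); lra.
(* The same relation for ['i *: v] kills the imaginary part. *)
move=> v1 v2 Av; have h1 := re0 _ _ Av.
have := re0 _ _ (A_lin 'i Av A0); rewrite !addr0 /rdot !linearZr_LR /=.
move: h1; rewrite /rdot.
case: (hdot (w1 - l1) v1) (hdot (w2 - l2) v2) => [a b] [a' b'] /= h1 h2.
by apply/eqP; rewrite eq_complex /= h1 eqxx /=; apply/eqP; lra.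
Qed.

End Projection.

(** * Carriers and reduced minimum modulus *)

Section LinearOperators.
Variables (R : realType) (H1 H2 : hilbertType R).
Implicit Types (T : linop H1 H2) (S : {linear H1 -> H2}).

(** Lets two successive perturbations be regrouped into one by a genuine equality of operators. *)
Lemma linop_ext T1 T2 : dom T1 = dom T2 -> op T1 = op T2 -> T1 = T2.
Proof.
case: T1 => d1 f1 a1 b1 c1; case: T2 => d2 f2 a2 b2 c2 /= ed ef.
by subst; congr LinOp; exact: Prop_irrelevance.
Qed.

Lemma op0 T : T 0 = 0.
Proof.
have := op_lin 1 (dom0 T) (dom0 T); rewrite !scale1r addr0 => T00.
by apply: (addrI (T 0)); rewrite -T00 addr0.
Qed.

Lemma domZ T c x : dom T x -> dom T (c *: x).
Proof. by move=> Tx; have := dom_lin c Tx (dom0 T); rewrite addr0. Qed.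

Lemma domD T x y : dom T x -> dom T y -> dom T (x + y).
Proof. by move=> Tx Ty; have := dom_lin 1 Tx Ty; rewrite scale1r. Qed.

Lemma domB T x y : dom T x -> dom T y -> dom T (x - y).
Proof. by move=> Tx Ty; rewrite -scaleN1r addrC; exact: dom_lin. Qed.

Lemma opZ T c x : dom T x -> T (c *: x) = c *: T x.
Proof. by move=> Tx; have := op_lin c Tx (dom0 T); rewrite op0 !addr0. Qed.

Lemma opD T x y : dom T x -> dom T y -> T (x + y) = T x + T y.
Proof. by move=> Tx Ty; have := op_lin 1 Tx Ty; rewrite !scale1r. Qed.

Lemma opB T x y : dom T x -> dom T y -> T (x - y) = T x - T y.
Proof.
by move=> Tx Ty; have := op_lin (-1) Ty Tx; rewrite !scaleN1r !(addrC (- _)).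
Qed.

(** Closedness of the graph in sequential form, which is what projections consume and what bounded
    perturbations preserve. *)
Definition seq_closed T := forall (u : nat -> H1) l m,
  (forall n, dom T (u n)) -> hcvg u l -> hcvg (fun n => T (u n)) m ->
  dom T l /\ T l = m.

Lemma closed_graph_seq T : closed (graph T) -> seq_closed T.
Proof.
move=> cl u l m Tu /hcvg_cvg ul /hcvg_cvg um.
have : graph T (l, m).
  apply: (@closed_cvg _ _ _ eventually_filter (fun n => (u n, T (u n))) (graph T)) => //.
    by apply: nearW => n; split => //=.
  exact: cvg_pair.
by case=> /= ? ->.
Qed.

(** Since [S] is continuous, [T (u n)] converges as the difference of [(T + S) (u n)] and
    [S (u n)]. *)
Lemma seq_closed_add T S : bounded_linear S -> seq_closed T ->
  seq_closed (add_linop T (total_linop S)).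
Proof.
move=> [M SM] Tcl u l m Tu ul /= um.
have Sul : hcvg (fun n => S (u n)) (S l).
  have c : (fun n => `|M| * hnorm (u n - l)) @ \oo --> (`|M| * 0 : R).
    by apply: cvgM => //; exact: cvg_cst.
  rewrite mulr0 in c; apply: (squeeze_cvgr _ (cvg_cst 0) c).
  apply: nearW => n; rewrite hnorm_ge0 -linearB/=; apply: le_trans (SM _) _.
  by rewrite ler_wpM2r ?hnorm_ge0// ler_norm.
have [||Tl Tlm] := Tcl u l (m - S l) _ ul.
- by move=> n; have [] := Tu n.
- by have := hcvgB um Sul; under eq_fun do rewrite addrK.
by split; [split|rewrite Tlm subrK].
Qed.

Lemma carrierZ T c x : carrier T x -> carrier T (c *: x).
Proof.
move=> [Tx ox]; split; first exact: domZ.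
by move=> y Ty; rewrite linearZl_LR /= ox ?mulr0.
Qed.

Lemma carrierB T x y : carrier T x -> carrier T y -> carrier T (x - y).
Proof.
move=> [Tx ox] [Ty oy]; split; first exact: domB.
by move=> z Tz; rewrite linearBl /= ox ?oy ?subrr.
Qed.

Lemma carrierD T x y : carrier T x -> carrier T y -> carrier T (x + y).
Proof.
move=> [Tx ox] [Ty oy]; split; first exact: domD.
by move=> z Tz; rewrite linearDl /= ox ?oy ?addr0.
Qed.

Lemma carrier0 T : carrier T 0.
Proof. by split; [exact: dom0|move=> y _; rewrite linear0l]. Qed.

Lemma hcvg_hdot0 (H : hilbertType R) (u : nat -> H) l y :
  (forall n, hdot (u n) y = 0) -> hcvg u l -> hdot l y = 0.
Proof.
move=> uy ul; apply: (@rdot_eq0_hdot _ _ l [set c *: y | c in setT]).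
- by move=> c _ [d _ <-]; exists (c * d) => //; rewrite scalerA.
- move=> _ [c _ <-]; have := cvg_rdot ul (hcvg_cst (c *: y)).
  have -> : (fun n => rdot (u n) (c *: y)) = fun=> 0.
    by apply/funext => n; rewrite /rdot linearZr_LR /= uy mulr0.
  by move=> h; apply/esym; apply: (cvg_unique _ (cvg_cst 0) h).
- by exists 1; rewrite ?scale1r.
Qed.

(** Closedness of [T] makes its null space closed, so [x] can be projected on it; the remainder
    stays in the domain because the null space lies in the domain. *)
Lemma null_carrier_decomp T x : seq_closed T -> dom T x ->
  exists n c, [/\ null T n, carrier T c & x = n + c].
Proof.
move=> Tcl Tx.
have [|||n [m [[Nn ->] h]]] :=
  @projection R H1 H2 (fun n m => null T n /\ m = 0) _ _ _ x 0.
- by split => //; split; [exact: dom0|exact: op0].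
- move=> c x1 x2 y1 y2 [[Tx1 x10] ->] [[Ty1 y10] ->].
  rewrite scaler0 addr0; split => //; split; first exact: dom_lin.
  by rewrite op_lin// x10 y10 scaler0 addr0.
- move=> u v l m uv ul vm.
  have m0 : m = 0.
    apply: (hcvg_unique vm); have -> : v = fun=> 0 by apply/funext => k; have [] := uv k.
    exact: hcvg_cst.
  split => //; apply: (Tcl u) => //; first by move=> k; have [[]] := uv k.
  have -> : (fun k => T (u k)) = fun=> 0 by apply/funext => k; have [[]] := uv k.
  exact: hcvg_cst.
exists n, (x - n); split; rewrite ?subrKC//.
have [Tn _] := Nn; split; first exact: domB.
by move=> y Ny; have := h y 0 (conj Ny erefl); rewrite linear0r addr0.
Qed.

(** Both operators ignore the null component of [x], so only injectivity of the sum on the carrier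
    matters. *)
Lemma null_add T S : seq_closed T -> (forall x, null T x -> S x = 0) ->
  (forall x, carrier T x -> T x + S x = 0 -> x = 0) ->
  null T = null (add_linop T (total_linop S)).
Proof.
move=> Tcl S0 inj; apply/seteqP; split => x /=.
  by move=> Nx; have [Tx Tx0] := Nx; split => //=; rewrite Tx0 S0// addr0.
move=> [/= [Tx _] TSx].
have [n [c [Nn Cc xnc]]] := null_carrier_decomp Tcl Tx.
have [Tn Tn0] := Nn; have [Tc _] := Cc.
suff c0 : c = 0 by rewrite xnc c0 addr0.
apply: inj => //; move: TSx.
by rewrite xnc opD// linearD /= Tn0 S0// !add0r.
Qed.

Lemma carrier_add T S : null T = null (add_linop T (total_linop S)) ->
  carrier (add_linop T (total_linop S)) = carrier T.
Proof.
by move=> NE; rewrite /carrier -NE; congr (_ `&` _); rewrite /= setIT.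
Qed.

Lemma hnorm_reduced_min_modulus T (k : R) x : (k%:E <= reduced_min_modulus T)%E ->
  carrier T x -> k * hnorm x <= hnorm (T x).
Proof.
move=> kT Cx; have [->|x0] := eqVneq x 0; first by rewrite op0 !hnorm0 mulr0.
have xp : 0 < hnorm x by rewrite lt_def hnorm_eq0 x0 hnorm_ge0.
rewrite -ler_pdivlMr// -lee_fin; apply: le_trans kT _.
apply: ereal_inf_lbound; exists ((hnorm x)^-1%:C *: x).
  by split; [exact: carrierZ|rewrite hnormZr normfV ger0_norm ?hnorm_ge0// mulVf// gt_eqF].
rewrite opZ; last by case: Cx.
by rewrite hnormZr normfV ger0_norm ?hnorm_ge0// mulrC.
Qed.

Lemma reduced_min_modulus_ge T (k : R) :
  (forall x, carrier T x -> k * hnorm x <= hnorm (T x)) ->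
  (k%:E <= reduced_min_modulus T)%E.
Proof.
move=> h; apply: le_ereal_inf_tmp => _ [x [Cx x1] <-].
by rewrite lee_fin; have := h x Cx; rewrite x1 mulr1.
Qed.

(** A vector outside the null space has a nonzero carrier component, which can be normalized. *)
Lemma exists_unit_carrier T : seq_closed T -> (exists2 x, dom T x & T x != 0) ->
  exists x, carrier T x /\ hnorm x = 1.
Proof.
move=> Tcl [x Tx x0]; have [n [c [[Tn Tn0] Cc xnc]]] := null_carrier_decomp Tcl Tx.
have [Tc _] := Cc.
have c0 : c != 0.
  by apply: contra_neq x0 => c0; rewrite xnc c0 addr0.
exists ((hnorm c)^-1%:C *: c); split; first exact: carrierZ.
by rewrite hnormZr normfV ger0_norm ?hnorm_ge0// mulVf// hnorm_eq0.
Qed.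

Lemma op_norm_le S (e : R) : (forall x, hnorm (S x) <= e * hnorm x) -> 0 <= e ->
  (op_norm S <= e%:E)%E.
Proof.
move=> Se e0; apply: ge_ereal_sup => _ [x /= x1 <-].
by rewrite lee_fin; apply: le_trans (Se x) _; rewrite ler_piMr.
Qed.

End LinearOperators.

(** * The rank one perturbation *)

Section RankOne.
Variables (R : realType) (H1 H2 : hilbertType R).
Implicit Types (T : linop H1 H2).

Definition tensor_op (y : H2) (a : H1) (x : H1) : H2 := hdot x a *: y.

Fact tensor_op_is_linear y a : linear (tensor_op y a).
Proof. by move=> c x z; rewrite /tensor_op linearPl /= scalerDl scalerA. Qed.

HB.instance Definition _ y a :=
  GRing.isLinear.Build _ _ _ _ (tensor_op y a) (tensor_op_is_linear y a).

Lemma hnorm_tensor_op y a x : hnorm (tensor_op y a x) <= hnorm a * hnorm y * hnorm x.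
Proof.
rewrite /tensor_op hnormZ mulrAC ler_wpM2r ?hnorm_ge0// mulrC.
exact: normc_hdot.
Qed.

Lemma hdot_unit (H : hilbertType R) (x : H) : hnorm x = 1 -> hdot x x = 1.
Proof. by move=> x1; rewrite hdot_norm normc_hnorm x1 expr1n. Qed.

Lemma rank_one_tensor_op y a : hnorm a = 1 -> y != 0 -> rank_one (tensor_op y a).
Proof.
move=> a1 y0; exists y => //; apply/seteqP; split => _ [c _ <-].
  by exists (hdot c a).
by exists (c *: a) => //; rewrite /= /tensor_op linearZl_LR /= hdot_unit// mulr1.
Qed.

Lemma rdotxxD (H : hilbertType R) (x y : H) : rdot x y = 0 ->
  hnorm (x + y) ^+ 2 = hnorm x ^+ 2 + hnorm y ^+ 2.
Proof. by move=> xy; rewrite -!rdotxx !rdotE (rdotC y x) xy addr0 add0r. Qed.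

(** [T z0] is the projection of [T x0] on the image of the carrier vectors orthogonal to [x0]. That
    image is closed because [T] is closed and bounded below on the carrier. *)
Lemma orthogonal_image_defect T (g : R) x0 : seq_closed T -> 0 < g ->
  (forall x, carrier T x -> g * hnorm x <= hnorm (T x)) ->
  carrier T x0 ->
  exists z0, [/\ carrier T z0, hdot z0 x0 = 0 &
    forall z, carrier T z -> hdot z x0 = 0 -> hdot (T x0 - T z0) (T z) = 0].
Proof.
move=> Tcl g0 gT Cx0.
have [|||u1 [u2 [[_ [z0 [Cz0 z00 ->]]] h]]] := @projection R H1 H2
  (fun y1 y2 => y1 = 0 /\ exists z, [/\ carrier T z, hdot z x0 = 0 & y2 = T z])
  _ _ _ 0 (T x0).
- by split => //; exists 0; split; [exact: carrier0|rewrite linear0l|rewrite op0].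
- move=> c x1 _ y1 _ [-> [z [Cz z0 ->]]] [-> [z' [Cz' z'0 ->]]].
  rewrite scaler0 addr0; split => //; exists (c *: z + z'); split.
  + by apply: carrierD => //; exact: carrierZ.
  + by rewrite linearPl /= z0 z'0 mulr0 addr0.
  + by have [? _] := Cz; have [? _] := Cz'; rewrite op_lin.
- move=> u v l m uv ul vm; split.
    apply: (hcvg_unique ul); have -> : u = fun=> 0 by apply/funext => k; have [] := uv k.
    exact: hcvg_cst.
  have /choice[z zE] n : exists z, [/\ carrier T z, hdot z x0 = 0 & v n = T z].
    by have [] := uv n.
  have Cz n : carrier T (z n) by have [] := zE n.
  have Tz n : dom T (z n) by have [] := Cz n.
  have vE : v = fun n => T (z n) by apply/funext => n; have [] := zE n.
  (* The lower bound [g] transfers the Cauchy property from the images to the preimages. *)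
  have [l' zl'] : exists l', hcvg z l'.
    apply: hcvg_complete => e e0.
    have /hcvgP/(_ _ (divr_gt0 (mulr_gt0 e0 g0) (ltr0Sn _ 1)))[N _ hN] := vm.
    exists N => i j Ni Nj; rewrite -(ltr_pM2l g0).
    apply: le_lt_trans (gT _ (carrierB (Cz i) (Cz j))) _.
    have := hN i Ni; have := hN j Nj; rewrite vE opB//.
    have := hnorm_triangle (T (z i) - m) (m - T (z j)).
    by rewrite addrA subrK (hdistC m); lra.
  have [|Tl' Tl'm] := Tcl z l' m Tz zl'; first by rewrite -vE.
  exists l'; split => //.
    split => // y Ny; apply: hcvg_hdot0 zl' => n; have [_] := Cz n; exact.
  by apply: hcvg_hdot0 zl' => n; have [] := zE n.
exists z0; split => // z Cz z0'.
have := h 0 (T z) (conj erefl _); rewrite linear0r add0r; apply.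
by exists z.
Qed.

(** A unit vector in the carrier rules out the value [+oo]. *)
Lemma pos_reduced_min_modulusE T : seq_closed T ->
  (exists2 x, dom T x & T x != 0) -> (0 < reduced_min_modulus T)%E ->
  exists2 g : R, 0 < g & reduced_min_modulus T = g%:E.
Proof.
move=> Tcl T0 pos; have [x [Cx x1]] := exists_unit_carrier Tcl T0.
have lt : (reduced_min_modulus T <= (hnorm (T x))%:E)%E.
  by apply: ereal_inf_lbound; exists x.
case: (reduced_min_modulus T) pos lt => [g||]//; first by rewrite lte_fin; exists g.
Qed.

Lemma rank_one_perturbation T (eps : R) : seq_closed T ->
  (exists2 x, dom T x & T x != 0) -> 0 < eps -> (0 < reduced_min_modulus T)%E ->
  exists S : {linear H1 -> H2},
    [/\ (forall x, hnorm (S x) <= eps * hnorm x),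
        null T = null (add_linop T (total_linop S)),
        attains_reduced_min (add_linop T (total_linop S)) &
        rank_one S].
Proof.
move=> Tcl T0 eps0 /(pos_reduced_min_modulusE Tcl T0)[g g0 gE].
have gT x : carrier T x -> g * hnorm x <= hnorm (T x).
  by apply: hnorm_reduced_min_modulus; rewrite gE.
(* The bound [d < g] keeps the new minimum [g - d] positive. The last two give [2 d <= eps / 2],
   which controls [(1 - t) |v|], and [(g + d)^2 - g^2 <= 3 g d <= (eps / 2)^2], which controls
   [|T z0|^2]. *)
have [d [d0 dg deps dgeps]] : exists d,
    [/\ 0 < d, d < g, 4 * d <= eps & 12 * g * d <= eps ^+ 2].
  exists (Num.min (g / 2) (Num.min (eps / 4) (eps ^+ 2 / (12 * g)))); split.
  - by rewrite !lt_min !divr_gt0 ?exprn_gt0 ?mulr_gt0.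
  - by rewrite gt_min; apply/orP; left; lra.
  - by rewrite mulrC -ler_pdivlMr// !ge_min lexx ?orbT.
  - by rewrite mulrC -ler_pdivlMr ?mulr_gt0// !ge_min lexx ?orbT.
have [_ [x0 [Cx0 x01] <-]] : exists2 y,
    [set (hnorm (T x))%:E | x in [set x | carrier T x /\ hnorm x = 1]] y &
    (y < (g + d)%:E)%E.
  by apply: ereal_inf_lt; rewrite -/(reduced_min_modulus T) gE lte_fin ltrDl.
rewrite lte_fin => Tx0.
have [z0 [Cz0 z00 Torth]] := orthogonal_image_defect Tcl g0 gT Cx0.
have [Dx0 _] := Cx0; have [Dz0 _] := Cz0.
(* As [z0] is orthogonal to [x0], the vector [x0 - z0] has norm at least 1. *)
have vg : g <= hnorm (T x0 - T z0).
  have := gT _ (carrierB Cx0 Cz0); rewrite opB//; apply: le_trans.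
  apply: ler_peMr; first exact: ltW.
  rewrite -(@ler_pXn2r _ 2) ?nnegrE ?hnorm_ge0// expr1n.
  rewrite rdotxxD; last by rewrite rdotNr rdotC hdot_rdot0// oppr0.
  by rewrite x01 hnorm_opp expr1n lerDl sqr_ge0.
have Tx0E : hnorm (T x0) ^+ 2 = hnorm (T x0 - T z0) ^+ 2 + hnorm (T z0) ^+ 2.
  by rewrite -rdotxxD ?subrK// hdot_rdot0// Torth.
have [v vE] : exists v, T x0 = v + T z0 by exists (T x0 - T z0); rewrite subrK.
have vE' : T x0 - T z0 = v by rewrite vE addrK.
rewrite vE' in vg Tx0E Torth.
have v0 : 0 < hnorm v by exact: lt_le_trans vg.
(* Scales [v] to norm [g - d], strictly below [g], so that [t < 1]. *)
pose t := (g - d) / hnorm v.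
have t0 : 0 < t by rewrite divr_gt0// subr_gt0.
have t1 : t < 1 by rewrite ltr_pdivrMr// mul1r; lra.
have tv : t * hnorm v = g - d by rewrite divfK// gt_eqF.
pose w := t%:C *: v - T x0.
(* The component of [w] along [v] is [(t - 1) v]; strictness of [t < 1] makes the rank exactly
   one. *)
have w0 : w != 0.
  apply/eqP => /(congr1 (fun w => rdot w v)); rewrite rdot0l /w.
  rewrite vE.
  rewrite !rdotE (rdotC (T z0)) (hdot_rdot0 (Torth _ Cz0 z00)) rdotxx addr0.
  move=> h; have : (t - 1) * hnorm v ^+ 2 = 0 by rewrite -h; ring.
  by move/eqP; rewrite mulf_eq0 sqrf_eq0 (gt_eqF v0) orbF subr_eq0 lt_eqF.
have Tz0 : hnorm (T z0) <= eps / 2.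
  rewrite -(@ler_pXn2r _ 2)// ?nnegrE ?hnorm_ge0 ?divr_ge0 ?ltW//.
  have := hnorm_ge0 (T x0); have := hnorm_ge0 v; nra.
have wle : hnorm w <= eps.
  have -> : w = (t - 1)%:C *: v - T z0.
    by rewrite /w vE rmorphB rmorph1 scalerBl scale1r opprD addrA.
  have := hnorm_triangle ((t - 1)%:C *: v) (- T z0).
  rewrite hnorm_opp hnormZr ler0_norm; last by rewrite subr_le0 ltW.
  have vx : hnorm v <= hnorm (T x0).
    by rewrite -(@ler_pXn2r _ 2)// ?nnegrE ?hnorm_ge0// Tx0E lerDl sqr_ge0.
  by lra.
pose S : {linear H1 -> H2} := tensor_op w x0.
(* On the carrier [T + S] is decoupled: [a x0 + z] goes to [a t v + T z], and both sums are
   orthogonal. *)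
have Sx0 x : carrier T x -> exists z, [/\ carrier T z, hdot z x0 = 0,
    x = hdot x x0 *: x0 + z & T x + S x = hdot x x0 *: (t%:C *: v) + T z].
  move=> Cx; have [Dx _] := Cx; exists (x - hdot x x0 *: x0); split.
  - by apply: carrierB => //; exact: carrierZ.
  - by rewrite linearBl /= linearZl_LR /= hdot_unit// mulr1 subrr.
  - by rewrite subrKC.
  - rewrite opB ?opZ//; last exact: domZ.
    rewrite /S /= /tensor_op /w scalerBr addrA [RHS]addrA; congr (_ - _); exact: addrC.
(* Pythagoras on both sides: the [x0] part is scaled exactly by [g - d], the rest by at least
   [g]. *)
have low x : carrier T x -> (g - d) * hnorm x <= hnorm (T x + S x).
  move=> Cx; have [z [Cz zx0 xE ->]] := Sx0 x Cx.
  rewrite -(@ler_pXn2r _ 2)// ?nnegrE ?hnorm_ge0 ?mulr_ge0 ?hnorm_ge0 ?subr_ge0 ?(ltW dg)//.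
  rewrite exprMn [in hnorm x]xE.
  rewrite rdotxxD; last first.
    by rewrite rdotC hdot_rdot0// linearZr_LR /= zx0 mulr0.
  rewrite rdotxxD; last first.
    by rewrite hdot_rdot0// linearZl_LR /= linearZl_LR /= Torth// !mulr0.
  rewrite !(hnormZ (hdot x x0)) hnormZr [`|t|]ger0_norm ?(ltW t0)// tv x01 mulr1.
  rewrite exprMn mulrDr [X in X + _]mulrC lerD2l -exprMn.
  rewrite ler_pXn2r ?nnegrE ?hnorm_ge0//; last first.
    by rewrite mulr_ge0 ?hnorm_ge0// subr_ge0 ltW.
  by apply: le_trans (gT z Cz); rewrite ler_wpM2r ?hnorm_ge0// gerBl ltW.
have NE : null T = null (add_linop T (total_linop S)).
  apply: null_add => //.
    move=> x Nx; rewrite /S /= /tensor_op (hdot_eq0C (_ : hdot x0 x = 0)) ?scale0r//.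
    by have [_] := Cx0; exact.
  move=> x Cx TSx; have := low x Cx; rewrite TSx hnorm0 pmulr_rle0 ?subr_gt0//.
  by move=> h; apply/eqP; rewrite -hnorm_eq0 eq_le h hnorm_ge0.
exists S; split => //.
- move=> x; apply: le_trans (hnorm_tensor_op _ _ _) _.
  by rewrite x01 mul1r ler_wpM2r// hnorm_ge0.
- exists x0; rewrite carrier_add//; split => //.
  have e : hnorm (T x0 + S x0) = g - d.
    rewrite /S /= /tensor_op hdot_unit// scale1r subrKC hnormZr ger0_norm//.
    exact: ltW.
  apply/eqP; rewrite eq_le; apply/andP; split; last first.
    by apply: ereal_inf_lbound; exists x0; rewrite ?carrier_add.
  rewrite /= e; apply: reduced_min_modulus_ge => x.
  by rewrite carrier_add//=; exact: low.
- exact: rank_one_tensor_op.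
Qed.

End RankOne.

(** * The perturbation bounded below *)

Section CentralBinomial.
Variable R : realType.

(* [binom(2n, n) / 4^n], the Taylor coefficients of [(1 - x)^(-1/2)]. *)
Fixpoint cbin (n : nat) : R :=
  if n is m.+1 then cbin m * ((2 * m + 1)%:R / (2 * m + 2)%:R) else 1.

Lemma cbin_ge0 n : 0 <= cbin n.
Proof. by elim: n => //= n IH; rewrite mulr_ge0 ?divr_ge0. Qed.

(** Coefficient form of [2 (1 - x) f' = f] for [f = (1 - x)^(-1/2)]. *)
Lemma cbinS n : n.+1%:R * cbin n.+1 *+ 2 = (2 * n + 1)%:R * cbin n.
Proof.
rewrite /= -mulr_natl.
have -> : (2 * n + 2 = 2 * n.+1)%N by rewrite mulnS addnC.
rewrite natrM; field.
by rewrite addrC natr1 pnatr_eq0.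
Qed.

(** Coefficient form of [f^2 = 1 / (1 - x)]. With [s] the convolution weighted by [i], symmetry
    gives [2 s m = m c m], and the recurrence gives [2 s (m + 1) = 2 s m + c m]; hence [c] is
    constant. *)
Lemma cbin_conv n : \sum_(i < n.+1) cbin i * cbin (n - i) = 1.
Proof.
pose c n := \sum_(i < n.+1) cbin i * cbin (n - i).
pose s n := \sum_(i < n.+1) i%:R * (cbin i * cbin (n - i)).
have sE m : s m *+ 2 = m%:R * c m.
  rewrite mulr2n {2}/s (reindex_inj rev_ord_inj) /= /s /c mulr_sumr -big_split /=.
  apply: eq_bigr => i _; rewrite subSS subKn -1?ltnS// natrB -1?ltnS//.
  by ring.
have step m : c m.+1 = c m.
  have m0 : m.+1%:R != 0 :> R by rewrite pnatr_eq0.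
  apply: (mulfI m0); rewrite -sE /s big_ord_recl mul0r add0r -sumrMnl.
  transitivity (s m *+ 2 + c m); last by rewrite sE -natr1 mulrDl mul1r.
  rewrite /s /c -sumrMnl -big_split /=; apply: eq_bigr => i _.
  rewrite -[bump 0 i]/i.+1 subSS mulrA -mulrnAl cbinS natrD natrM.
  by rewrite -[in RHS]mulr_natl; ring.
rewrite -/(c n); elim: n => [|n <-]; last exact: step.
by rewrite /c big_ord_recl big_ord0 /= mulr1 addr0.
Qed.

(** Grouping the terms by [i + j] makes the Hankel form of [b] a sum over the coefficients of the
    square of its polynomial. *)
Lemma sum_sum_coef (b d : nat -> R) m (p := \poly_(i < m) b i) :
  \sum_(i < m) \sum_(j < m) b i * b j * d (i + j)%N =
  \sum_(n < m + m) (p * p)`_n * d n.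
Proof.
have -> : p * p = \sum_(i < m) \sum_(j < m) (b i * b j) *: 'X^(i + j).
  rewrite /p !poly_def mulr_suml; apply: eq_bigr => i _.
  rewrite mulr_sumr; apply: eq_bigr => j _.
  by rewrite -scalerAl -scalerAr scalerA exprD.
under [RHS]eq_bigr do rewrite coef_sum mulr_suml.
rewrite [RHS]exchange_big; apply: eq_bigr => i _ /=.
under [RHS]eq_bigr do rewrite coef_sum mulr_suml.
rewrite [RHS]exchange_big; apply: eq_bigr => j _ /=.
have ij : (i + j < m + m)%N by rewrite -addnS leq_add// ltnW.
rewrite (bigD1 (Ordinal ij))//= coefZ coefXn eqxx mulr1 big1 ?addr0// => n nij.
rewrite coefZ coefXn [(_ == _)%N](_ : _ = false) ?mulr0 ?mul0r//.
by apply: contra_neqF nij => /eqP nij; apply/val_inj.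
Qed.

(** The coefficients of the square are at most those of [a * a = 1], and vanish below [k + k], where
    one of the two factors has index below [k]. *)
Lemma cbin_sum_le (d : nat -> R) k m
    (b := fun i => if (k <= i)%N then cbin i else 0) : (forall n, 0 <= d n) ->
  \sum_(i < m) \sum_(j < m) b i * b j * d (i + j)%N <=
  \sum_(k + k <= n < m + m) d n.
Proof.
move=> d0; rewrite sum_sum_coef (big_nat_widenl _ 0)// big_mkord [leRHS]big_mkcond.
apply: ler_sum => n _; set p := \poly_(i < m) b i.
have pE i : 0 <= p`_i <= cbin i.
  by rewrite coef_poly /b; case: ifP => _; [case: ifP => _|]; rewrite ?lexx cbin_ge0.
rewrite coefM; case: ifP => kn.
  rewrite ler_piMl// -(cbin_conv n); apply: ler_sum => i _.
  have /andP[? ?] := pE i; have /andP[? ?] := pE (n - i)%N.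
  by apply: ler_pM.
rewrite big1 ?mul0r// => i _.
have [ki|ik] := leqP k i; last first.
  by rewrite coef_poly /b [(k <= i)%N]leqNgt ik /= if_same mul0r.
have [kni|nik] := leqP k (n - i)%N; last first.
  by rewrite [X in _ * X]coef_poly /b [(k <= _)%N]leqNgt nik /= if_same mulr0.
by have := leq_add ki kni; rewrite (subnKC (leq_ord i)); move: kn => /= ->.
Qed.

(** Below [m] truncation does not affect the convolution, so the coefficients equal 1; the later
    ones are nonnegative. *)
Lemma cbin_sum_ge (d : nat -> R) m : (forall n, 0 <= d n) ->
  \sum_(n < m) d n <=
  \sum_(i < m) \sum_(j < m) cbin i * cbin j * d (i + j)%N.
Proof.
move=> d0; rewrite sum_sum_coef big_split_ord /= -[leLHS]addr0.
set p := \poly_(i < m) cbin i.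
have p0 i : 0 <= p`_i by rewrite coef_poly; case: ifP => // _; exact: cbin_ge0.
apply: lerD; last first.
  apply: sumr_ge0 => n _; rewrite mulr_ge0// coefM sumr_ge0// => i _.
  by rewrite mulr_ge0.
apply: ler_sum => n _; rewrite coefM (eq_bigr (fun i : 'I_n.+1 => cbin i * cbin (n - i))).
  by rewrite cbin_conv mul1r.
move=> i _; rewrite !coef_poly.
have im : (i < m)%N by exact: leq_trans (ltn_ord i) (ltn_ord n).
by rewrite im (leq_ltn_trans (leq_subr _ _) (ltn_ord n)).
Qed.

End CentralBinomial.

(** * The resolvent [(1 + T^* T)^-1], its moments and the series for [Q] *)

Section Resolvent.
Variables (R : realType) (H1 H2 : hilbertType R) (T : linop H1 H2).
Hypothesis Tcl : seq_closed T.

(** Subtract the two equations and test with [u - w]: [|u - w|^2 + |T (u - w)|^2 = 0]. *)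
Lemma resolvent_unique z u w : dom T u -> dom T w ->
  (forall v, dom T v -> rdot (z - u) v = rdot (T u) (T v)) ->
  (forall v, dom T v -> rdot (z - w) v = rdot (T w) (T v)) -> u = w.
Proof.
move=> Tu Tw uE wE; have Td := domB Tu Tw.
apply/eqP; rewrite -subr_eq0 -rdotxx_eq0 eq_le rdot_ge0 andbT.
have := uE _ Td; have := wE _ Td; have := rdot_ge0 (T (u - w)).
by rewrite opB// !rdotE; lra.
Qed.

(* [B = (1 + T^* T)^-1]: the projection of [(x, 0)] on the graph of [T] is
   [(B x, T (B x))]. *)
Lemma exists_resolvent : exists B : {linear H1 -> H1},
  forall x, dom T (B x) /\
    forall v, dom T v -> hdot (x - B x) v = hdot (T (B x)) (T v).
Proof.
have /choice[B BE] x : exists u, dom T u /\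
    forall v, dom T v -> hdot (x - u) v = hdot (T u) (T v).
  have [|||u [_ [[Tu ->] h]]] :=
    @projection R H1 H2 (fun u w => dom T u /\ w = T u) _ _ _ x 0.
  - by split; [exact: dom0|rewrite op0].
  - move=> c x1 _ y1 _ [Tx1 ->] [Ty1 ->].
    by split; [exact: dom_lin|rewrite op_lin].
  - move=> u w l m uw ul wm; have Tu n : dom T (u n) by have [] := uw n.
    have [|Tl Tlm] := Tcl Tu ul (m := m); last by [].
    have -> // : (fun n => T (u n)) = w.
    by apply/funext => n; have [] := uw n.
  - exists u; split => // v Tv; have := h v (T v) (conj Tv erefl).
    by rewrite sub0r linearNl => /eqP; rewrite subr_eq0 => /eqP.
have Blin : linear B.
  move=> c x y; have [Tu uE] := BE (c *: x + y).
  have [Tx xE] := BE x; have [Ty yE] := BE y.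
  apply: (@resolvent_unique (c *: x + y)) => //; first exact: dom_lin.
    by move=> v Tv; rewrite /rdot uE.
  move=> v Tv; rewrite opprD addrACA -scalerBr op_lin// /rdot.
  by rewrite !linearPl /= xE// yE.
pose BL : {linear H1 -> H1} := HB.pack B (GRing.isLinear.Build _ _ _ _ B Blin).
by exists BL.
Qed.

Variable B : {linear H1 -> H1}.
Hypothesis BE : forall x, dom T (B x) /\
    forall v, dom T v -> hdot (x - B x) v = hdot (T (B x)) (T v).

Let BT x : dom T (B x). Proof. by have [] := BE x. Qed.
Let BP x v : dom T v -> rdot (x - B x) v = rdot (T (B x)) (T v).
Proof. by move=> Tv; rewrite /rdot; have [_ ->] := BE x. Qed.

Let mu x n := rdot (iter n B x) x.

(** The quantity [rdot (x - B x) (B y) = rdot (T (B x)) (T (B y))] is symmetric in [x] and [y]. *)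
Lemma resolvent_sym x y : rdot (B x) y = rdot x (B y).
Proof.
have := BP x (BT y); have := BP y (BT x).
by rewrite (rdotC (T (B y))) !rdotE (rdotC (B y)) (rdotC y); lra.
Qed.

Lemma rdot_iter_resolvent i j x : rdot (iter i B x) (iter j B x) = mu x (i + j).
Proof.
elim: j i => [|j IH] i; first by rewrite addn0.
by rewrite [iter j.+1 B x]iterS -resolvent_sym -iterS IH addSnnS.
Qed.

(** This is [T^* T B = 1 - B] in weak form: the Gram matrix of the terms of the series is Hankel. *)
Lemma rdot_op_iter_resolvent i j x :
  rdot (T (B (iter i B x))) (T (B (iter j B x))) =
  mu x (i + j).+1 - mu x (i + j).+2.
Proof.
by rewrite -BP// rdotDl rdotNl -!iterS !rdot_iter_resolvent addnS addSn addnS.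
Qed.

(** With [u = B^k x] and [k] half of [n], the odd case is [<u - B u, B u> >= 0], and the even case
    adds [|u - B u|^2] to it. *)
Lemma moment_nonincreasing x n : mu x n.+1 <= mu x n.
Proof.
have h u : 0 <= rdot (u - B u) (B u) by rewrite BP// rdot_ge0.
rewrite -subr_ge0 -(odd_double_half n) -addnn; case: (odd n) => /=.
  have := h (iter n./2 B x).
  by rewrite rdotDl rdotNl -!iterS !rdot_iter_resolvent !addSn !addnS add0n.
have := h (iter n./2 B x); have := rdot_ge0 (iter n./2 B x - B (iter n./2 B x)).
rewrite !rdotE -!iterS !rdot_iter_resolvent add0n !addSn !addnS; lra.
Qed.

(** By monotonicity the moment dominates that of index [n + n], which is [|B^n x|^2]. *)
Lemma moment_ge0 x n : 0 <= mu x n.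
Proof.
have mono m k : mu x (m + k)%N <= mu x m.
  elim: k => [|k IH]; first by rewrite addn0.
  by apply: le_trans IH; rewrite addnS; exact: moment_nonincreasing.
by apply: le_trans (mono n n); rewrite -rdot_iter_resolvent rdot_ge0.
Qed.

Lemma moment_cvg x : exists2 l, forall n, l <= mu x n & mu x @ \oo --> l.
Proof.
have dec : nonincreasing_seq (mu x).
  by apply/nonincreasing_seqP => n; exact: moment_nonincreasing.
have cv : cvgn (mu x).
  apply: nonincreasing_is_cvgn => //; exists 0 => _ [n _ <-]; exact: moment_ge0.
by exists (limn (mu x)) => // n; exact: nonincreasing_cvgn_ge.
Qed.

Lemma hnorm_resolvent x : hnorm (B x) <= hnorm x.
Proof.
rewrite -(@ler_pXn2r _ 2) ?nnegrE ?hnorm_ge0// -!rdotxx.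
rewrite -[x in leRHS]/(iter 0 B x) -[B x]/(iter 1 B x) !rdot_iter_resolvent.
by apply: le_trans (moment_nonincreasing _ _) (moment_nonincreasing _ _).
Qed.

Lemma hcvg_resolvent (u : nat -> H1) l : hcvg u l -> hcvg (fun n => B (u n)) (B l).
Proof.
move=> ul; apply: (squeeze_cvgr _ (cvg_cst 0) ul).
by apply: nearW => n; rewrite hnorm_ge0 -linearB hnorm_resolvent.
Qed.

(* The iterates [B^n x] are Cauchy because their Gram matrix is a Hankel matrix
   of the moments; their limit is fixed by [B], hence lies in the null space. *)
Lemma moment_carrier_cvg0 x : carrier T x -> mu x @ \oo --> (0 : R).
Proof.
move=> [Tx Nx]; have [l lmu mul] := moment_cvg x.
have [y xy] : exists y, hcvg (fun n => iter n B x) y.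
  apply: hcvg_complete => e e0.
  have e2 : 0 < e ^+ 2 / 2 by rewrite divr_gt0 ?exprn_gt0.
  have /cvgrPdist_lt/(_ _ e2)[N _ hN] := mul.
  have near_l n : (N <= n)%N -> mu x n < l + e ^+ 2 / 2.
    move=> /hN /=; rewrite ltr_norml => /andP[h _]; lra.
  exists N => i j Ni Nj; rewrite -(@ltr_pXn2r _ 2) ?nnegrE ?hnorm_ge0 ?(ltW e0)//.
  rewrite -rdotxx !rdotE !rdot_iter_resolvent (addnC j i).
  have := near_l (i + i)%N (leq_trans Ni (leq_addr _ _)).
  have := near_l (j + j)%N (leq_trans Nj (leq_addr _ _)).
  have := lmu (i + j)%N; lra.
have By : B y = y.
  apply: (hcvg_unique (hcvg_resolvent xy)).
  by move: xy; rewrite /hcvg -(cvg_shiftS (fun n => hnorm (iter n B x - y))).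
(* Testing the equation of [B y = y] with [y] itself gives [|T y|^2 = 0]. *)
have Ny : null T y.
  split; first by rewrite -By.
  have := BP y (BT y); rewrite By subrr rdot0l => /esym/eqP.
  by rewrite rdotxx_eq0 => /eqP.
have := cvg_rdot xy (hcvg_cst x).
by rewrite (hdot_rdot0 (hdot_eq0C (Nx _ Ny))).
Qed.

(* Partial sums of [T B (1 - B)^(-1/2)]. *)
Definition resolvent_series x m : H2 :=
  \sum_(i < m) (cbin R i)%:C *: T (B (iter i B x)).

Let d x n := mu x n.+1 - mu x n.+2.

Let d_ge0 x n : 0 <= d x n.
Proof. by rewrite subr_ge0 moment_nonincreasing. Qed.

Let norm_sum (b : nat -> R) x m :
  hnorm (\sum_(i < m) (b i)%:C *: T (B (iter i B x))) ^+ 2 =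
  \sum_(i < m) \sum_(j < m) b i * b j * d x (i + j)%N.
Proof.
rewrite -rdotxx rdot_suml; apply: eq_bigr => i _.
rewrite rdot_sumr; apply: eq_bigr => j _.
by rewrite rdotZl rdotZr rdot_op_iter_resolvent mulrA.
Qed.

Let sum_d x k m : (k <= m)%N -> \sum_(k <= n < m) d x n = mu x k.+1 - mu x m.+1.
Proof.
move=> km; rewrite -[RHS]opprB -(telescope_sumr (fun n => mu x n.+1) km).
by rewrite -sumrN; apply: eq_bigr => n _; rewrite opprB.
Qed.

(** The difference is the series with coefficients below [k] set to 0; its Hankel form is bounded by
    a telescoping sum of moments. *)
Lemma resolvent_series_tail x k m : (k <= m)%N ->
  hnorm (resolvent_series x m - resolvent_series x k) ^+ 2 <=
  mu x (k + k).+1 - mu x (m + m).+1.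
Proof.
move=> km; rewrite -(sum_d _ (leq_add km km)).
apply: le_trans (cbin_sum_le k m (d_ge0 x)).
rewrite -(norm_sum (fun i => if (k <= i)%N then cbin R i else 0)).
rewrite le_eqVlt; apply/orP; left; apply/eqP; congr (hnorm _ ^+ 2).
rewrite /resolvent_series -!(big_mkord xpredT (fun i => (_ i)%:C *: T (B (iter i B x)))).
rewrite !(big_cat_nat (leq0n k) km)/= [X in X - _]addrC addrK.
rewrite (big_nat_widenl _ 0)// big_mkord big_mkcond; apply: eq_bigr => i _ /=.
by case: ifP => // _; rewrite scale0r.
Qed.

Lemma resolvent_series_le x m : hnorm (resolvent_series x m) <= hnorm x.
Proof.
rewrite -(@ler_pXn2r _ 2) ?nnegrE ?hnorm_ge0//.
have := resolvent_series_tail x (leq0n m).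
rewrite [resolvent_series x 0]big_ord0 subr0 => /le_trans; apply.
have := moment_ge0 x (m + m).+1; have := moment_nonincreasing x 0.
by rewrite -rdotxx /mu /=; lra.
Qed.

Lemma resolvent_series_ge x m :
  mu x 1 - mu x m.+1 <= hnorm (resolvent_series x m) ^+ 2.
Proof.
rewrite norm_sum; apply: le_trans (cbin_sum_ge m (d_ge0 x)).
by rewrite -(big_mkord xpredT (d x)) sum_d.
Qed.

Lemma resolvent_series_cvg x : exists l, hcvg (resolvent_series x) l.
Proof.
have [l lmu mul] := moment_cvg x.
apply: hcvg_complete => e e0; have e2 : 0 < e ^+ 2 by rewrite exprn_gt0.
have /cvgrPdist_lt/(_ _ e2)[N _ hN] := mul.
have tail k m : (N <= k)%N -> (k <= m)%N ->
    hnorm (resolvent_series x m - resolvent_series x k) < e.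
  move=> Nk km; rewrite -(@ltr_pXn2r _ 2) ?nnegrE ?hnorm_ge0 ?(ltW e0)//.
  apply: le_lt_trans (resolvent_series_tail x km) _.
  have := hN (k + k).+1 (leq_trans Nk (leqW (leq_addr _ _))) => /=.
  by rewrite ltr_norml => /andP[h _]; have := lmu (m + m).+1; lra.
exists N => i j Ni Nj; have [ij|/ltnW ji] := leqP i j; last exact: tail.
by rewrite hdistC; exact: tail.
Qed.

Lemma exists_resolvent_series_limit : exists Q : {linear H1 -> H2},
  forall x, hcvg (resolvent_series x) (Q x).
Proof.
have /choice[Q QE] := resolvent_series_cvg.
have Qlin : linear Q.
  move=> c x y; apply: (hcvg_unique (QE _)).
  have := hcvgD (hcvgZ c (QE x)) (QE y).
  congr hcvg; apply/funext => m; rewrite /resolvent_series scaler_sumr -big_split.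
  apply: eq_bigr => i _ /=.
  have -> : iter i B (c *: x + y) = c *: iter i B x + iter i B y.
    by elim: {1 2 3}(i : nat) => //= n ->; rewrite linearP.
  by rewrite linearP op_lin// scalerDr !scalerA mulrC.
pose QL : {linear H1 -> H2} := HB.pack Q (GRing.isLinear.Build _ _ _ _ Q Qlin).
by exists QL.
Qed.

Variable Q : {linear H1 -> H2}.
Hypothesis QE : forall x, hcvg (resolvent_series x) (Q x).

Lemma resolvent_series_limit_le x : hnorm (Q x) <= hnorm x.
Proof.
apply: (ler_cvg_to (cvg_hnorm (QE x)) (cvg_cst (hnorm x))).
by apply: nearW => m; exact: resolvent_series_le.
Qed.

(** In the bound [mu x 1 - mu x m.+1] the subtracted moment tends to 0 on the carrier. *)
Lemma resolvent_series_limit_ge x : carrier T x ->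
  rdot (B x) x <= hnorm (Q x) ^+ 2.
Proof.
move=> Cx.
have c1 : (fun m => mu x 1 - mu x m.+1) @ \oo --> mu x 1 - 0.
  apply: cvgB; first exact: cvg_cst.
  by rewrite (cvg_shiftS (mu x)); exact: moment_carrier_cvg0.
have c2 := cvg_rdot (QE x) (QE x).
rewrite subr0 in c1; rewrite -rdotxx; apply: (ler_cvg_to c1 c2).
by apply: nearW => m; rewrite rdotxx resolvent_series_ge.
Qed.

(** Term by term, [<T B B^i x, T x> = <B^i x - B^(i+1) x, x>] is a difference of consecutive
    moments. *)
Lemma resolvent_series_limit_accretive x : dom T x -> 0 <= rdot (Q x) (T x).
Proof.
move=> Tx; apply: (ler_cvg_to (cvg_cst 0) (cvg_rdot (QE x) (hcvg_cst (T x)))).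
apply: nearW => m; rewrite rdot_suml sumr_ge0// => i _.
rewrite rdotZl -BP// mulr_ge0 ?cbin_ge0// rdotDl rdotNl -iterS.
by rewrite subr_ge0 moment_nonincreasing.
Qed.

(** [B] fixes the null space, so every term of the series is a multiple of [T x = 0]. *)
Lemma resolvent_series_limit_null x : null T x -> Q x = 0.
Proof.
move=> [Tx Tx0].
have Bx : B x = x.
  apply: (@resolvent_unique x) => // [v|v _]; first exact: BP.
  by rewrite Tx0 subrr !rdot0l.
apply: (hcvg_unique (QE x)).
have -> : resolvent_series x = fun=> 0; last exact: hcvg_cst.
apply/funext => m; rewrite /resolvent_series big1// => i _.
have -> : iter i B x = x by elim: {1}(i : nat) => //= n ->.
by rewrite Bx Tx0 scaler0.
Qed.

(** Apply [2 <a, b> <= |a|^2 + |b|^2] to [|x|^2 - <B x, x> = <T B x, T x>], with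
    [|T B x|^2 <= <B x, x>]. Thus [<B x, x>] and [|T x|] are not both small. *)
Lemma resolvent_rdot x : dom T x ->
  hnorm x ^+ 2 <= rdot (B x) x + (rdot (B x) x + hnorm (T x) ^+ 2) / 2.
Proof.
move=> Tx; have := BP x Tx; rewrite rdotDl rdotNl rdotxx.
have := rdot_op_iter_resolvent 0 0 x; have := moment_ge0 x 2.
have := rdot_ge0 (T (B x) - T x).
rewrite /mu /= !rdotE (rdotC (T x)) rdotxx.
rewrite (rdotxx (T x)); lra.
Qed.

End Resolvent.

(** For [S = delta Q] the cross term is nonnegative, so [|T x + S x|^2 >= |T x|^2 + delta^2 |Q
    x|^2], while [|x|^2 <= 3/2 (|Q x|^2 + |T x|^2)] on the carrier. *)
Lemma bounded_below_perturbation (R : realType) (H1 H2 : hilbertType R)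
    (T : linop H1 H2) (delta : R) : seq_closed T -> 0 < delta ->
  exists (S : {linear H1 -> H2}) (k : R), [/\ 0 < k,
    forall x, hnorm (S x) <= delta * hnorm x,
    forall x, null T x -> S x = 0 &
    forall x, carrier T x -> k * hnorm x <= hnorm (T x + S x)].
Proof.
move=> Tcl delta0.
have [B BE] := exists_resolvent Tcl.
have [Q QE] := exists_resolvent_series_limit BE.
pose S : {linear H1 -> H2} := delta%:C \*: Q.
(* [k^2] must lie below both weights, 1 for [|T x|^2] and [delta^2] for [|Q x|^2]. *)
have [k [k0 k1 kdelta]] : exists k : R, [/\ 0 < k, k <= 1 & k <= delta].
  by exists (Num.min 1 delta); rewrite lt_min ltr01 !ge_min !lexx orbT.
exists S, (k / 2).
split; first by rewrite divr_gt0.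
- move=> x; rewrite /S /= hnormZr gtr0_norm// ler_pM2l//.
  exact: resolvent_series_limit_le.
- by move=> x Nx; rewrite /S /= (resolvent_series_limit_null BE QE Nx) scaler0.
move=> x Cx; have [Tx _] := Cx.
have acc := resolvent_series_limit_accretive BE QE Tx.
have Qge := resolvent_series_limit_ge BE QE Cx.
have xle := resolvent_rdot BE Tx.
rewrite -(@ler_pXn2r _ 2) ?nnegrE ?hnorm_ge0//; last first.
  by rewrite mulr_ge0 ?hnorm_ge0// divr_ge0// ltW.
rewrite -[leRHS]rdotxx /S /= !rdotE (rdotC (T x)) !rdotxx exprMn expr_div_n.
have k2 : k ^+ 2 <= 1 by rewrite exprn_ile1// ltW.
have kd2 : k ^+ 2 <= delta ^+ 2 by rewrite ler_pXn2r ?nnegrE ?(ltW k0) ?(ltW delta0).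
have kk := sqr_ge0 k.
have tx := sqr_ge0 (hnorm (T x)); have qx := sqr_ge0 (hnorm (Q x)).
have da : 0 <= delta * rdot (Q x) (T x) by rewrite mulr_ge0// ltW.
have h1 : k ^+ 2 * hnorm (T x) ^+ 2 <= hnorm (T x) ^+ 2 by rewrite ler_piMl.
have h2 : k ^+ 2 * hnorm (Q x) ^+ 2 <= delta ^+ 2 * hnorm (Q x) ^+ 2.
  by rewrite ler_wpM2r.
have h3 : k ^+ 2 * hnorm x ^+ 2 <=
    k ^+ 2 * (3 / 2 * (hnorm (Q x) ^+ 2 + hnorm (T x) ^+ 2)).
  by rewrite ler_wpM2l//; lra.
have dq : 0 <= delta ^+ 2 * hnorm (Q x) ^+ 2 by rewrite mulr_ge0 ?sqr_ge0.
by lra.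
Qed.

Unset Implicit Arguments.

(* [hT0] excludes the zero operator, for which the conclusion is false: there
   N(T) = H1, so (2) forces S = 0 and then C(T + S) = {0} has no unit vector. *)
Theorem theorem3p23 (R : realType) (H1 H2 : hilbertType R)
    (infH1 : infinite_dim H1) (infH2 : infinite_dim H2)
    (T : linop H1 H2) (hT : closed_densely_defined T)
    (hT0 : exists2 x, dom T x & T x != 0)
    (eps : R) (heps : 0 < eps) :
  (exists S : {linear H1 -> H2},
     [/\ bounded_linear S,
         (op_norm S <= eps%:E)%E,
         null T = null (add_linop T (total_linop S)) &
         attains_reduced_min (add_linop T (total_linop S))]) /\
  ((0 < reduced_min_modulus T)%E ->
   exists S : {linear H1 -> H2},
     [/\ bounded_linear S,
         (op_norm S <= eps%:E)%E,
         null T = null (add_linop T (total_linop S)),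
         attains_reduced_min (add_linop T (total_linop S)) &
         rank_one S]).
Proof.
have Tcl : seq_closed T by apply: closed_graph_seq; case: hT.
split; last first.
  move=> pos; have [S [Se NS aS rS]] := rank_one_perturbation Tcl hT0 heps pos.
  by exists S; split => //; [exists eps|apply: op_norm_le => //; exact: ltW].
(* Half of [eps] pays for making the operator bounded below, half for the rank one correction. *)
have eps2 : 0 < eps / 2 by rewrite divr_gt0.
have [S1 [k [k0 S1e S10 low]]] := bounded_below_perturbation Tcl eps2.
have N1 : null T = null (add_linop T (total_linop S1)).
  apply: null_add => // x Cx TSx; have := low x Cx.
  rewrite TSx hnorm0 pmulr_rle0// => x0.
  by apply/eqP; rewrite -hnorm_eq0 eq_le x0 hnorm_ge0.
pose T1 := add_linop T (total_linop S1).
have T1cl : seq_closed T1 by apply: seq_closed_add => //; exists (eps / 2).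
(* [T1] is nonzero because it has the same null space as [T]. *)
have T10 : exists2 x, dom T1 x & T1 x != 0.
  have [x Tx Tx0] := hT0; exists x => //; apply/eqP => T1x.
  have : null T1 x by [].
  by rewrite /T1 -N1 => -[_ /eqP]; apply/negP.
have pos : (0 < reduced_min_modulus T1)%E.
  apply: (@lt_le_trans _ _ k%:E); first by rewrite lte_fin.
  apply: reduced_min_modulus_ge => x; rewrite /T1 carrier_add//; exact: low.
have [S2 [S2e N2 aS _]] := rank_one_perturbation T1cl T10 eps2 pos.
pose S : {linear H1 -> H2} := S1 \+ S2.
have TSE : add_linop T1 (total_linop S2) = add_linop T (total_linop S).
  by apply: linop_ext => /=; [rewrite !setIT|apply/funext => x; rewrite addrA].
have Se x : hnorm (S x) <= eps * hnorm x.
  apply: le_trans (hnorm_triangle _ _) _.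
  by have := S1e x; have := S2e x; lra.
exists S; split; rewrite -?TSE//; first by exists eps.
- by apply: op_norm_le => //; exact: ltW.
- by rewrite N1.
Qed.
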